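(* Let $L$ be a residuated lattice and $\mathcal{F}=\{F_i : i\in I\}$ a system of filters of $L$. Then the following are equivalent: (i) $(L,\mathcal{T}_{\mathcal{F}})$ is a Hausdorff space; (ii) $(L,\mathcal{T}_{\mathcal{F}})$ is a $T_1$-space; (iii) $(L,\mathcal{T}_{\mathcal{F}})$ is a $T_0$-space; (iv) $\bigcap_{i\in I}F_i=\{1\}$; (v) $L$ is a subdirect product of the family $\{L/F_i : i\in I\}$ of residuated lattices.
   Context: A residuated lattice is an algebra $(L,\wedge,\vee,\odot,\rightarrow,0,1)$ such that $(L,\wedge,\vee,0,1)$ is a bounded lattice, $(L,\odot,1)$ is a commutative monoid, and $x\odot y\le z$ iff $x\le y\rightarrow z$. A filter is a nonempty subset closed under $\odot$ and upward closed. For a filter $F$, $\theta_F=\{(x,y):(x\rightarrow y)\odot(y\rightarrow x)\in F\}$ is a congruence; $x/F$ is the class of $x$ and $L/F$ the quotient residuated lattice. A system of filters is a nonempty family $\mathcal{F}$ of filters that is down-directed under $\subseteq$. The topology induced by $\mathcal{F}$ is $\mathcal{T}_{\mathcal{F}}=\{U\subseteq L:\forall x\in U\ \exists F\in\mathcal{F},\ x/F\subseteq U\}$. $L$ is a subdirect product of residuated lattices $L_i$ if there is an embedding $L\to\prod_i L_i$ whose composition with each projection is surjective.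
   Formalization: In (v), ''L is a subdirect product of the family {L/F_i}'' is taken to mean that the canonical map x ↦ (x/F_i)_i is a subdirect embedding; with an arbitrary embedding (v) does not imply (iv), e.g. L = 2^ℕ and the single filter F = {f : f(n) = 1 for n ≥ 1}. *)

(* Defs.v *)
From HB Require Import structures.
From mathcomp Require Import all_boot all_order.
From mathcomp Require Import generic_quotient.
From mathcomp Require Import boolp classical_sets topology.

Set Implicit Arguments.
Unset Strict Implicit.
Unset Printing Implicit Defensive.

Import Order.TTheory.
Local Open Scope classical_set_scope.
Local Open Scope order_scope.
Local Open Scope quotient_scope.

Reserved Notation "x ⊙ y" (at level 40, left associativity).
Reserved Notation "x ⇒ y" (at level 55, right associativity).

(* 0 and 1 are written \bot and \top; the case 0 = 1 is not excluded. *)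
HB.mixin Record isResiduated (d : Order.disp_t) L of Order.TBLattice d L := {
  odot : L -> L -> L;
  resid : L -> L -> L;
  odotA : associative odot;
  odotC : commutative odot;
  odot1x : left_id \top odot;
  residuation : forall x y z : L, (odot x y <= z) = (x <= resid y z)
}.

#[short(type="residuatedLatticeType")]
HB.structure Definition ResiduatedLattice (d : Order.disp_t) :=
  { L of Order.TBLattice d L & isResiduated d L }.

Notation "x ⊙ y" := (odot x y) : order_scope.
Notation "x ⇒ y" := (resid x y) : order_scope.

Section ResiduatedTheory.
Context {d : Order.disp_t} {L : residuatedLatticeType d}.
Implicit Types x y z u : L.

Lemma odotx1 x : x ⊙ \top = x.
Proof. by rewrite odotC odot1x. Qed.

Lemma odot_le2 x y z u : x <= y -> z <= u -> x ⊙ z <= y ⊙ u.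
Proof.
move=> xy zu; have le_l (a b c : L) : a <= b -> a ⊙ c <= b ⊙ c.
  by move=> ab; rewrite residuation (le_trans ab)// -residuation.
by rewrite (le_trans (le_l _ _ _ xy))// ![y ⊙ _]odotC le_l.
Qed.

Lemma odot_lel x y : x ⊙ y <= x.
Proof. by rewrite -[leRHS]odotx1 odot_le2// lex1. Qed.

Lemma odot_ler x y : x ⊙ y <= y.
Proof. by rewrite odotC odot_lel. Qed.

Lemma resid_mp x y : (x ⇒ y) ⊙ x <= y.
Proof. by rewrite residuation. Qed.

Lemma resid_eq1 x y : (x ⇒ y == \top) = (x <= y).
Proof. by rewrite -[y in RHS]meet1x eq_le lex1/= -residuation odot1x meet1x. Qed.

Lemma le_resid1 x y : x <= y -> x ⇒ y = \top.
Proof. by rewrite -resid_eq1 => /eqP. Qed.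

Lemma resid_trans x y z : (x ⇒ y) ⊙ (y ⇒ z) <= x ⇒ z.
Proof.
rewrite -residuation [(x ⇒ y) ⊙ _]odotC -odotA.
exact: le_trans (odot_le2 (lexx _) (resid_mp _ _)) (resid_mp _ _).
Qed.

End ResiduatedTheory.

Record rlFilter (d : Order.disp_t) (L : residuatedLatticeType d) := RlFilter {
  rlfilter_set :> L -> Prop;
  rlfilter_neq0 : [set x | rlfilter_set x] !=set0;
  rlfilter_odot : forall x y,
    rlfilter_set x -> rlfilter_set y -> rlfilter_set (x ⊙ y);
  rlfilter_le : forall x y, x <= y -> rlfilter_set x -> rlfilter_set y
}.

Section FilterCongruence.
Context {d : Order.disp_t} {L : residuatedLatticeType d} (F : rlFilter L).
Implicit Types x y z u : L.

Definition rltheta x y : Prop := F ((x ⇒ y) ⊙ (y ⇒ x)).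

(* x/F as a subset of L *)
Definition rlclass x : set L := [set y | rltheta x y].

Lemma rlfilter1 : F \top.
Proof. by have [x Fx] := rlfilter_neq0 F; apply: rlfilter_le Fx; rewrite lex1. Qed.

Lemma rlthetaE x y : rltheta x y <-> F (x ⇒ y) /\ F (y ⇒ x).
Proof.
split=> [Fxy|[Fxy Fyx]]; last exact: rlfilter_odot.
by split; apply: rlfilter_le Fxy; rewrite ?odot_lel ?odot_ler.
Qed.

Lemma rltheta_refl x : rltheta x x.
Proof. by apply/rlthetaE; rewrite le_resid1//; split; apply: rlfilter1. Qed.

Lemma rltheta_sym x y : rltheta x y -> rltheta y x.
Proof. by move=> /rlthetaE[? ?]; apply/rlthetaE. Qed.

Lemma rlfilter_resid_trans x y z : F (x ⇒ y) -> F (y ⇒ z) -> F (x ⇒ z).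
Proof.
by move=> xy yz; apply: rlfilter_le (rlfilter_odot xy yz); apply: resid_trans.
Qed.

Lemma rltheta_trans x y z : rltheta x y -> rltheta y z -> rltheta x z.
Proof.
move=> /rlthetaE[xy yx] /rlthetaE[yz zy]; apply/rlthetaE.
by split; apply: rlfilter_resid_trans; eassumption.
Qed.

Lemma rlfilter_resid_le x y : x <= y -> F (x ⇒ y).
Proof. by move=> /le_resid1 ->; apply: rlfilter1. Qed.

Lemma rlfilter_meet x y z : F (x ⇒ y) -> F (x ⇒ z) -> F (x ⇒ (y `&` z)).
Proof.
move=> xy xz; apply: rlfilter_le (rlfilter_odot xy xz).
rewrite -residuation lexI; apply/andP; split.
  exact: le_trans (odot_le2 (odot_lel _ _) (lexx _)) (resid_mp _ _).
exact: le_trans (odot_le2 (odot_ler _ _) (lexx _)) (resid_mp _ _).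
Qed.

Lemma rlfilter_join x y z : F (x ⇒ z) -> F (y ⇒ z) -> F ((x `|` y) ⇒ z).
Proof.
move=> xz yz; apply: rlfilter_le (rlfilter_odot xz yz).
rewrite -residuation odotC residuation leUx -!residuation.
apply/andP; split; rewrite odotC.
  exact: le_trans (odot_le2 (odot_lel _ _) (lexx _)) (resid_mp _ _).
exact: le_trans (odot_le2 (odot_ler _ _) (lexx _)) (resid_mp _ _).
Qed.

Lemma rltheta_le2 x y z u : rltheta x y -> rltheta z u ->
  F (x ⇒ z) -> F (y ⇒ u).
Proof.
move=> /rlthetaE[_ yx] /rlthetaE[zu _] xz.
exact: rlfilter_resid_trans yx (rlfilter_resid_trans xz zu).
Qed.

Let congruence2 (op : L -> L -> L) :
  (forall x y z u, rltheta x y -> rltheta z u -> F (op x z ⇒ op y u)) ->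
  forall x y z u, rltheta x y -> rltheta z u -> rltheta (op x z) (op y u).
Proof.
move=> H x y z u xy zu; apply/rlthetaE.
by split; apply: H => //; apply: rltheta_sym.
Qed.

Lemma rltheta_meet x y z u :
  rltheta x y -> rltheta z u -> rltheta (x `&` z) (y `&` u).
Proof.
apply: congruence2 => {x y z u} x y z u /rlthetaE[xy _] /rlthetaE[zu _].
apply: rlfilter_meet; [apply: rlfilter_resid_trans xy|apply: rlfilter_resid_trans zu].
  by apply: rlfilter_resid_le; rewrite leIl.
by apply: rlfilter_resid_le; rewrite leIr.
Qed.

Lemma rltheta_join x y z u :
  rltheta x y -> rltheta z u -> rltheta (x `|` z) (y `|` u).
Proof.
apply: congruence2 => {x y z u} x y z u /rlthetaE[xy _] /rlthetaE[zu _].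
apply: rlfilter_join; [apply: rlfilter_resid_trans xy _|apply: rlfilter_resid_trans zu _].
  by apply: rlfilter_resid_le; rewrite leUl.
by apply: rlfilter_resid_le; rewrite leUr.
Qed.

Lemma rltheta_odot x y z u :
  rltheta x y -> rltheta z u -> rltheta (x ⊙ z) (y ⊙ u).
Proof.
apply: congruence2 => {x y z u} x y z u /rlthetaE[xy _] /rlthetaE[zu _].
apply: rlfilter_le (rlfilter_odot xy zu); rewrite -residuation.
rewrite -odotA [(z ⇒ u) ⊙ _]odotC -odotA odotA [z ⊙ _]odotC.
by rewrite odot_le2// resid_mp.
Qed.

Lemma rltheta_resid x y z u :
  rltheta x y -> rltheta z u -> rltheta (x ⇒ z) (y ⇒ u).
Proof.
apply: congruence2 => {x y z u} x y z u /rlthetaE[_ yx] /rlthetaE[zu _].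
apply: rlfilter_le (rlfilter_odot yx zu); rewrite -!residuation.
rewrite -!odotA [(z ⇒ u) ⊙ _]odotC odotA odotA [(y ⇒ x) ⊙ _]odotC -[_ ⊙ (y ⇒ x) ⊙ y]odotA.
apply: le_trans (odot_le2 (odot_le2 (lexx _) (resid_mp _ _)) (lexx _)) _.
by rewrite (le_trans (odot_le2 (resid_mp _ _) (lexx _)))// odotC resid_mp.
Qed.

Definition rltheta_rel : rel L := fun x y => `[< rltheta x y >].

Lemma rltheta_is_equiv : equiv_class_of rltheta_rel.
Proof.
split=> [x|x y|y x z]; first by apply/asboolP/rltheta_refl.
  by apply/asboolP/asboolP; apply: rltheta_sym.
by move=> /asboolP xy /asboolP yz; apply/asboolP/(rltheta_trans xy yz).
Qed.

Canonical rltheta_equiv := EquivRelPack rltheta_is_equiv.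
Canonical rltheta_encModRel := defaultEncModRel rltheta_rel.

Definition rlquot := {eq_quot rltheta_rel}.

HB.instance Definition _ : EqQuotient L rltheta_rel rlquot :=
  EqQuotient.on rlquot.
HB.instance Definition _ := Choice.on rlquot.

End FilterCongruence.

Arguments rltheta {d L} F x y.
Arguments rlclass {d L} F x.

(* The operations of L/F are those induced by L on the classes (see the
   rlpi lemmas below); its order is the one of the induced meet. *)
Section Quotient.
Context {d : Order.disp_t} {L : residuatedLatticeType d} (F : rlFilter L).
Implicit Types (x y z : L) (a b c : rlquot F).

Definition rlpi (x : L) : rlquot F := \pi_(rlquot F) x.

Definition rlquot_op2 (op : L -> L -> L) a b := rlpi (op (repr a) (repr b)).

Lemma rlpiP x y : rlpi x = rlpi y <-> rltheta F x y.
Proof.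
split=> [/(@eqquotP _ _ (rlquot F))/asboolP//|xy].
by apply/(@eqquotP _ _ (rlquot F))/asboolP.
Qed.

Lemma reprKpi a : rlpi (repr a) = a.
Proof. exact: reprK. Qed.

Lemma rlquot_op2E op :
  (forall x y z u, rltheta F x y -> rltheta F z u ->
    rltheta F (op x z) (op y u)) ->
  forall x y, rlquot_op2 op (rlpi x) (rlpi y) = rlpi (op x y).
Proof. by move=> H x y; apply/rlpiP/H; apply/rlpiP; rewrite reprKpi. Qed.

Definition rlquot_meet := rlquot_op2 Order.meet.
Definition rlquot_join := rlquot_op2 Order.join.
Definition rlquot_odot := rlquot_op2 odot.
Definition rlquot_resid := rlquot_op2 resid.
Definition rlquot_le : rel (rlquot F) := fun a b => rlquot_meet a b == a.

Let meetE x y : rlquot_meet (rlpi x) (rlpi y) = rlpi (x `&` y).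
Proof. exact/rlquot_op2E/rltheta_meet. Qed.
Let joinE x y : rlquot_join (rlpi x) (rlpi y) = rlpi (x `|` y).
Proof. exact/rlquot_op2E/rltheta_join. Qed.
Let odotE x y : rlquot_odot (rlpi x) (rlpi y) = rlpi (x ⊙ y).
Proof. exact/rlquot_op2E/rltheta_odot. Qed.
Let residE x y : rlquot_resid (rlpi x) (rlpi y) = rlpi (x ⇒ y).
Proof. exact/rlquot_op2E/rltheta_resid. Qed.

Let leP x y : reflect (F (x ⇒ y)) (rlquot_le (rlpi x) (rlpi y)).
Proof.
rewrite /rlquot_le meetE; apply: (iffP eqP) => [/rlpiP/rlthetaE[_ H]|H].
  apply: rlfilter_resid_trans H _.
  by apply: rlfilter_resid_le; rewrite leIr.
apply/rlpiP/rlthetaE; split; first by apply: rlfilter_resid_le; rewrite leIl.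
by apply: rlfilter_meet => //; apply: rlfilter_resid_le.
Qed.

Let le_refl : reflexive rlquot_le.
Proof. by move=> a; rewrite -(reprKpi a); apply/leP/rlfilter_resid_le. Qed.

Let le_anti : antisymmetric rlquot_le.
Proof.
move=> a b; rewrite -(reprKpi a) -(reprKpi b) => /andP[/leP ab /leP ba].
exact/rlpiP/rlthetaE.
Qed.

Let le_trans : transitive rlquot_le.
Proof.
move=> b a c; rewrite -(reprKpi a) -(reprKpi b) -(reprKpi c) => /leP ab /leP bc.
exact/leP/(rlfilter_resid_trans ab bc).
Qed.

HB.instance Definition _ :=
  Order.Le_isPOrder.Build d (rlquot F) le_refl le_anti le_trans.

Let lexI a b c : (a <= rlquot_meet b c) = (a <= b) && (a <= c).
Proof.
rewrite -(reprKpi a) -(reprKpi b) -(reprKpi c) meetE.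
apply/leP/andP => [H|[/leP ab /leP ac]]; last exact: rlfilter_meet.
by split; apply/leP; apply: rlfilter_resid_trans H _; apply: rlfilter_resid_le;
  rewrite ?leIl ?leIr.
Qed.

Let leUx a b c : (rlquot_join a b <= c) = (a <= c) && (b <= c).
Proof.
rewrite -(reprKpi a) -(reprKpi b) -(reprKpi c) joinE.
apply/leP/andP => [H|[/leP ac /leP bc]]; last exact: rlfilter_join.
by split; apply/leP; apply: rlfilter_resid_trans H; apply: rlfilter_resid_le;
  rewrite ?leUl ?leUr.
Qed.

HB.instance Definition _ :=
  Order.POrder_isMeetSemilattice.Build d (rlquot F) lexI.
HB.instance Definition _ :=
  Order.POrder_isJoinSemilattice.Build d (rlquot F) leUx.

Let le0x a : rlpi \bot <= a.
Proof.
by rewrite -(reprKpi a); apply/leP/rlfilter_resid_le; rewrite Order.le0x.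
Qed.

Let lex1 a : a <= rlpi \top.
Proof.
by rewrite -(reprKpi a); apply/leP/rlfilter_resid_le; rewrite Order.lex1.
Qed.

HB.instance Definition _ := Order.hasBottom.Build d (rlquot F) le0x.
HB.instance Definition _ := Order.hasTop.Build d (rlquot F) lex1.

Let odotA_ : associative rlquot_odot.
Proof.
move=> a b c; rewrite -(reprKpi a) -(reprKpi b) -(reprKpi c) !odotE.
by rewrite odotA.
Qed.

Let odotC_ : commutative rlquot_odot.
Proof. by move=> a b; rewrite -(reprKpi a) -(reprKpi b) !odotE odotC. Qed.

Let odot1x_ : left_id \top rlquot_odot.
Proof. by move=> a; rewrite -(reprKpi a) odotE odot1x. Qed.

Let residuation_ a b c : (rlquot_odot a b <= c) = (a <= rlquot_resid b c).
Proof.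
rewrite -(reprKpi a) -(reprKpi b) -(reprKpi c) odotE residE.
set x := repr a; set y := repr b; set z := repr c.
have curry : ((x ⊙ y) ⇒ z) = (x ⇒ (y ⇒ z)).
  apply/eqP; rewrite eq_le -!residuation; apply/andP; split.
    by rewrite -odotA resid_mp.
  rewrite odotA; apply: Order.POrderTheory.le_trans (resid_mp y z).
  by rewrite odot_le2// resid_mp.
by apply/leP/leP; rewrite curry.
Qed.

HB.instance Definition _ :=
  isResiduated.Build d (rlquot F) odotA_ odotC_ odot1x_ residuation_.

Lemma rlpi_meet x y : rlpi (x `&` y) = rlpi x `&` rlpi y.
Proof. by rewrite -meetE. Qed.
Lemma rlpi_join x y : rlpi (x `|` y) = rlpi x `|` rlpi y.
Proof. by rewrite -joinE. Qed.
Lemma rlpi_odot x y : rlpi (x ⊙ y) = rlpi x ⊙ rlpi y.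
Proof. by rewrite -odotE. Qed.
Lemma rlpi_resid x y : rlpi (x ⇒ y) = (rlpi x ⇒ rlpi y).
Proof. by rewrite -residE. Qed.
Lemma rlpi_bot : rlpi \bot = \bot. Proof. by []. Qed.
Lemma rlpi_top : rlpi \top = \top. Proof. by []. Qed.

End Quotient.

Definition rlprod (d : Order.disp_t) (I : Type)
  (M : I -> residuatedLatticeType d) : Type := forall i, M i.

Section Product.
Context {d : Order.disp_t} {I : Type} (M : I -> residuatedLatticeType d).
Implicit Types f g h : rlprod M.

HB.instance Definition _ := gen_eqMixin (rlprod M).
HB.instance Definition _ := gen_choiceMixin (rlprod M).

Definition rlprod_le : rel (rlprod M) := fun f g => `[< forall i, f i <= g i >].
Definition rlprod_meet f g : rlprod M := fun i => f i `&` g i.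
Definition rlprod_join f g : rlprod M := fun i => f i `|` g i.
Definition rlprod_odot f g : rlprod M := fun i => f i ⊙ g i.
Definition rlprod_resid f g : rlprod M := fun i => f i ⇒ g i.
Definition rlprod_bot : rlprod M := fun=> \bot.
Definition rlprod_top : rlprod M := fun=> \top.

Let le_refl : reflexive rlprod_le.
Proof. by move=> f; apply/asboolP. Qed.

Let le_anti : antisymmetric rlprod_le.
Proof.
move=> f g /andP[/asboolP fg /asboolP gf]; apply: functional_extensionality_dep.
by move=> i; apply/eqP; rewrite eq_le fg gf.
Qed.

Let le_trans : transitive rlprod_le.
Proof.
by move=> g f h /asboolP fg /asboolP gh; apply/asboolP => i; apply: le_trans (gh i).
Qed.

HB.instance Definition _ :=
  Order.Le_isPOrder.Build d (rlprod M) le_refl le_anti le_trans.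

Let lexI f g h : (f <= rlprod_meet g h) = (f <= g) && (f <= h).
Proof.
apply/asboolP/andP => [H|[/asboolP fg /asboolP fh] i]; last by rewrite lexI fg fh.
by split; apply/asboolP => i; have := H i; rewrite lexI => /andP[].
Qed.

Let leUx f g h : (rlprod_join f g <= h) = (f <= h) && (g <= h).
Proof.
apply/asboolP/andP => [H|[/asboolP fh /asboolP gh] i]; last by rewrite leUx fh gh.
by split; apply/asboolP => i; have := H i; rewrite leUx => /andP[].
Qed.

HB.instance Definition _ :=
  Order.POrder_isMeetSemilattice.Build d (rlprod M) lexI.
HB.instance Definition _ :=
  Order.POrder_isJoinSemilattice.Build d (rlprod M) leUx.

Let le0x f : rlprod_bot <= f.
Proof. by apply/asboolP => i; rewrite le0x. Qed.

Let lex1 f : f <= rlprod_top.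
Proof. by apply/asboolP => i; rewrite lex1. Qed.

HB.instance Definition _ := Order.hasBottom.Build d (rlprod M) le0x.
HB.instance Definition _ := Order.hasTop.Build d (rlprod M) lex1.

Let odotA_ : associative rlprod_odot.
Proof.
by move=> f g h; apply: functional_extensionality_dep => i; apply: odotA.
Qed.

Let odotC_ : commutative rlprod_odot.
Proof.
by move=> f g; apply: functional_extensionality_dep => i; apply: odotC.
Qed.

Let odot1x_ : left_id \top rlprod_odot.
Proof.
by move=> f; apply: functional_extensionality_dep => i; apply: odot1x.
Qed.

Let residuation_ f g h : (rlprod_odot f g <= h) = (f <= rlprod_resid g h).
Proof.
by apply/asboolP/asboolP => H i; have := H i; rewrite residuation.
Qed.

HB.instance Definition _ :=
  isResiduated.Build d (rlprod M) odotA_ odotC_ odot1x_ residuation_.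

End Product.

Record rlhom (d d' : Order.disp_t) (L : residuatedLatticeType d)
    (M : residuatedLatticeType d') (f : L -> M) : Prop := {
  rlhom_meet : {morph f : x y / x `&` y};
  rlhom_join : {morph f : x y / x `|` y};
  rlhom_odot : {morph f : x y / x ⊙ y};
  rlhom_resid : {morph f : x y / x ⇒ y};
  rlhom_bot : f \bot = \bot;
  rlhom_top : f \top = \top
}.

Definition rlembedding (d d' : Order.disp_t) (L : residuatedLatticeType d)
    (M : residuatedLatticeType d') (f : L -> M) : Prop :=
  rlhom f /\ injective f.

(* e exhibits L as a subdirect product of the family M *)
Definition subdirect_embedding (d d' : Order.disp_t)
    (L : residuatedLatticeType d) (I : Type)
    (M : I -> residuatedLatticeType d') (e : L -> rlprod M) : Prop :=
  rlembedding e /\ forall i, range (fun x => e x i) = [set: M i].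

(* The map x |-> (x/F_i)_i.  "L is a subdirect product of the family {L/F_i}"
   means that this map is a subdirect embedding.  The existence of some
   subdirect embedding of L into the product is strictly weaker: for a single
   filter F it only says that L/F is isomorphic to L, which can happen with F
   different from {1} (e.g. L = 2^nat and F = {f | f n = 1 for all n > 0}). *)
Definition rlpi_prod (d : Order.disp_t) (L : residuatedLatticeType d)
    (I : Type) (F : I -> rlFilter L) (x : L) :
    rlprod (fun i => rlquot (F i) : residuatedLatticeType d) :=
  fun i => rlpi (F i) x.

Record filter_system (d : Order.disp_t) (L : residuatedLatticeType d)
    (I : Type) (F : I -> rlFilter L) : Prop := FilterSystem {
  filter_system_inhabited : inhabited I;
  filter_system_directed : forall i j, exists k, F k `<=` F i `&` F j
}.

(* L as a topological space; the proof that F is a system is an argument since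
   the sets below are closed under intersection only in that case. *)
Definition rlspace (d : Order.disp_t) (L : residuatedLatticeType d)
  (I : Type) (F : I -> rlFilter L) (sF : filter_system F) : Type := L.

Section FilterTopology.
Context {d : Order.disp_t} {L : residuatedLatticeType d} {I : Type}.
Context (F : I -> rlFilter L) (sF : filter_system F).

Definition rlopen : set (set L) :=
  [set U | forall x, U x -> exists i, rlclass (F i) x `<=` U].

HB.instance Definition _ := Choice.copy (rlspace sF) L.

Let opT : rlopen setT.
Proof. by move=> x _; have [i] := filter_system_inhabited sF; exists i. Qed.

Let opI : setI_closed rlopen.
Proof.
move=> U V oU oV x [/oU[i iU] /oV[j jV]].
have [k kij] := filter_system_directed sF i j; exists k => y /kij[iy jy].
by split; [apply: iU|apply: jV].
Qed.

Let op_bigU (J : Type) (f : J -> set L) :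
  (forall j, rlopen (f j)) -> rlopen (\bigcup_j f j).
Proof.
move=> of_ x [j _ /of_[i ifj]]; exists i => y iy.
by exists j => //; apply: ifj.
Qed.

HB.instance Definition _ := isOpenTopological.Build (rlspace sF) opT opI op_bigU.

Lemma rlspace_openE : @open (rlspace sF) = rlopen.
Proof. by []. Qed.

End FilterTopology.

(* Main.v *)
Require Import Defs.
From mathcomp Require Import all_boot all_order.
From mathcomp Require Import boolp classical_sets topology separation_axioms.

(** For T0 => (iv): an element of every F_i lies in the same F_i-class as 1 for
    all i, so it is topologically indistinguishable from 1.  For (v) => T2:
    injectivity separates two points by some F_i, and the classes of F_i are
    open and partition L. *)

Set Implicit Arguments.
Unset Strict Implicit.
Unset Printing Implicit Defensive.

Import Order.TTheory.
Local Open Scope classical_set_scope.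
Local Open Scope order_scope.

Section Filters.
Context {d : Order.disp_t} {L : residuatedLatticeType d}.

(** By residuation [x ⊙ \top = x] gives [x <= \top ⇒ x], so the filter contains [\top ⇒ x]; the
    other residuum is [\top]. *)
Lemma rltheta_top (F : rlFilter L) (x : L) : F x -> rltheta F x \top.
Proof.
move=> Fx; apply/rlthetaE; rewrite le_resid1 ?lex1//; split; first exact: rlfilter1.
by apply: rlfilter_le Fx; rewrite -residuation odotx1.
Qed.

(** A product lies below both factors, so both residua are [\top], which gives both inequalities
    between [x] and [y]. *)
Lemma resid_odot_eq1 (x y : L) : (x ⇒ y) ⊙ (y ⇒ x) = \top -> x = y.
Proof.
move=> xy1; apply/eqP; rewrite eq_le -!resid_eq1 -!le1x -xy1.
by rewrite odot_lel odot_ler.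
Qed.

Lemma rlpi_hom (F : rlFilter L) : rlhom (rlpi F).
Proof.
split; [exact: rlpi_meet|exact: rlpi_join|exact: rlpi_odot|exact: rlpi_resid| |].
- exact: rlpi_bot.
- exact: rlpi_top.
Qed.

End Filters.

Lemma rlhom_prod (d d' : Order.disp_t) (L : residuatedLatticeType d)
    (I : Type) (M : I -> residuatedLatticeType d') (e : L -> rlprod M) :
  (forall i, rlhom (fun x => e x i)) -> rlhom e.
Proof.
move=> he; split=> [x y|x y|x y|x y||]; apply: functional_extensionality_dep => i.
- exact: (rlhom_meet (he i)).
- exact: (rlhom_join (he i)).
- exact: (rlhom_odot (he i)).
- exact: (rlhom_resid (he i)).
- exact: (rlhom_bot (he i)).
- exact: (rlhom_top (he i)).
Qed.

Section CanonicalMap.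
Context {d : Order.disp_t} {L : residuatedLatticeType d} {I : Type}.

Lemma rlpi_prod_inj (F : I -> rlFilter L) :
  \bigcap_i F i = [set \top] -> injective (rlpi_prod F).
Proof.
move=> F1 x y xy; apply: resid_odot_eq1.
(* Membership of this element in [F i] is by definition the congruence of [x] and [y] modulo [F i],
   that is, equality of the [i]-th coordinates. *)
suff : (\bigcap_i F i) ((x ⇒ y) ⊙ (y ⇒ x)) by rewrite F1.
by move=> i _; apply/rlpiP; apply: (congr1 (@^~ i) xy).
Qed.

(** Each coordinate is a quotient map, hence a surjective homomorphism; injectivity is the only
    further condition. *)
Lemma rlpi_prod_subdirect (F : I -> rlFilter L) :
  injective (rlpi_prod F) -> subdirect_embedding (rlpi_prod F).
Proof.
move=> inj; split; first by split=> //; apply: rlhom_prod => i; apply: rlpi_hom.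
move=> i; apply/seteqP; split=> // a _.
by exists (repr a) => //; apply: reprKpi.
Qed.

End CanonicalMap.

Section Topology.
Context {d : Order.disp_t} {L : residuatedLatticeType d} {I : Type}.
Context (F : I -> rlFilter L) (sF : filter_system F).

(** By transitivity a class contains the class of each of its points, so the same index [i] serves
    at every point. *)
Lemma rlclass_open (i : I) (x : L) : @open (rlspace sF) (rlclass (F i) x).
Proof.
by rewrite rlspace_openE => y xy; exists i => z; apply: rltheta_trans.
Qed.

Lemma nbhs_rlclass (x : rlspace sF) (A : set (rlspace sF)) :
  nbhs x A -> exists i, rlclass (F i) x `<=` A.
Proof.
rewrite nbhsE => -[U [oU Ux] UA].
have [i iU] := oU x Ux; exists i.
exact: subset_trans iU UA.
Qed.

Lemma kolmogorov_bigcap :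
  kolmogorov_space (rlspace sF) -> \bigcap_i F i = [set \top].
Proof.
move=> T0; apply/seteqP; split=> [x Fx|_ -> i _]; last exact: rlfilter1.
apply/eqP/negP => /negP /T0[A].
have x1 i : rltheta (F i) x \top by apply: rltheta_top; apply: Fx.
(* Whichever of [x] and [\top] has [A] as a neighbourhood, its class lies in [A] and contains the
   other point. *)
case=> -[/set_mem/nbhs_rlclass[i iA] /set_mem]; apply; apply: iA.
  exact: x1.
exact/rltheta_sym/x1.
Qed.

Lemma rlpi_prod_inj_hausdorff :
  injective (rlpi_prod F) -> hausdorff_space (rlspace sF).
Proof.
move=> inj; rewrite open_hausdorff => x y /eqP xy.
have [i nxy] : exists i, ~ rltheta (F i) x y.
  apply/existsNP => xyF; apply/xy/inj; apply: functional_extensionality_dep => i.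
  exact/rlpiP/xyF.
exists (rlclass (F i) x, rlclass (F i) y) => /=.
  by split; apply/mem_set/rltheta_refl.
split; [exact: rlclass_open|exact: rlclass_open|].
apply/eqP/seteqP; split=> // z [xz yz].
(* A common point [z] of the two classes would make [x] and [y] congruent modulo [F i]. *)
exact/nxy/(rltheta_trans xz)/rltheta_sym.
Qed.

End Topology.

Theorem theorem4p7 (d : Order.disp_t) (L : residuatedLatticeType d) (I : Type)
    (F : I -> rlFilter L) (sF : filter_system F) :
  [<-> hausdorff_space (rlspace sF);
       accessible_space (rlspace sF);
       kolmogorov_space (rlspace sF);
       (\bigcap_i F i = [set Order.top])%classic;
       subdirect_embedding (rlpi_prod F)].
Proof.
tfae.
- exact: hausdorff_accessible.
- exact: accessible_kolmogorov.
- exact: kolmogorov_bigcap.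
- by move=> F1; apply/rlpi_prod_subdirect/rlpi_prod_inj.
- by move=> [[_ inj] _]; apply: rlpi_prod_inj_hausdorff.
Qed.
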